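(* The Wick product map $W:H\to H$, $W(A)={:}A{:}$, associated with a family $(X_a)_{a\in\mathcal A}$ of real-valued random variables with finite moments of all orders, is equal to $\phi_{\mu^{-1}}$, where $\mu(A)=\mathbb{E}(X^A)$ is the moment functional. Therefore $$W:(H,\cdot,\emptyset,\Delta,\varepsilon)\to(H,\cdot_\mu,\emptyset,\Delta_\mu,\varepsilon_\mu)$$ is a Hopf algebra isomorphism; in particular $${:}A_1\cdot A_2{:}\;=\;{:}A_1{:}\,\cdot_\mu\,{:}A_2{:}$$ for all $A_1,A_2\in H$.
   Context: Let $(X_a)_{a\in\mathcal A}$ be real-valued random variables on a probability space, each with finite moments of all orders. $\mathcal M(\mathcal A)$ is the set of finitely supported functions $\mathcal A\to\mathbb{N}=\{0,1,2,\dots\}$, a commutative monoid for $(A\cdot B)(a):=A(a)+B(a)$ with neutral element the zero function $\emptyset$. For $B\in\mathcal M(\mathcal A)$, $X^B:=\prod_{a:B(a)>0}X_a^{B(a)}$, with $X^\emptyset:=1$. For $A,B_1,B_2\in\mathcal M(\mathcal A)$ put $\binom{A}{B_1\,B_2}:=\mathbf 1_{(B_1\cdot B_2=A)}\prod_{a}\frac{A(a)!}{B_1(a)!B_2(a)!}$. $H$ is the real vector space freely generated by $\mathcal M(\mathcal A)$, a commutative cocommutative Hopf algebra with product $\cdot$, unit $\emptyset$, coproduct $\Delta A:=\sum_{B_1,B_2}\binom{A}{B_1\,B_2}B_1\otimes B_2$, counit $\varepsilon(A)=\mathbf 1_{(A=\emptyset)}$ ($A\in\mathcal M(\mathcal A)$).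 On $H^*$, $(f\star g)(A):=(f\otimes g)\Delta A$; $\mathcal G(H):=\{\lambda\in H^*:\lambda(\emptyset)=1\}$ is a group for $\star$ with unit $\varepsilon$. The moment functional $\mu\in\mathcal G(H)$ is $\mu(A):=\mathbb{E}(X^A)$, $A\in\mathcal M(\mathcal A)$. The Wick product map $W:H\to H$, written $W(A)={:}A{:}$, is the linear map defined by recursion on $|A|=\sum_aA(a)$ by ${:}\emptyset{:}=\emptyset$ and $A=\sum_{B_1,B_2\in\mathcal M(\mathcal A)}\binom{A}{B_1\,B_2}\,\mathbb{E}(X^{B_1})\;{:}B_2{:}$ for $A\in\mathcal M(\mathcal A)$. For $\lambda\in\mathcal G(H)$, $\phi_\lambda:=(\lambda\otimes\mathrm{id})\Delta:H\to H$, which is invertible with $\phi_\lambda^{-1}=\phi_{\lambda^{-1}}$, and the deformed structure is $A\cdot_\lambda B:=\phi_\lambda^{-1}(\phi_\lambda(A)\cdot\phi_\lambda(B))$, $\Delta_\lambda:=(\phi_\lambda^{-1}\otimes\phi_\lambda^{-1})\Delta\phi_\lambda$, $\varepsilon_\lambda:=\varepsilon\circ\phi_\lambda=\lambda$. *)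

(* Defs.v *)
From HB Require Import structures.
From mathcomp Require Import all_boot all_order all_algebra ring.
From mathcomp Require Import finmap monalg.
From mathcomp Require Import all_classical all_reals all_analysis.

Set Implicit Arguments.
Unset Strict Implicit.
Unset Printing Implicit Defensive.

Import Order.TTheory GRing.Theory Num.Theory.
Local Open Scope classical_set_scope.
Local Open Scope ring_scope.

(* {malg R[K]} is the vector space freely generated by K, with basis <<k>>.
   The tensor product of {malg R[K]} and {malg R[L]} is realised as
   {malg R[K * L]}: the basis vector <<(k, l)>> is <<k>> (x) <<l>>. *)

Section FreeModules.
Context {R : realType}.

Definition linext {K : choiceType} {V : lmodType R} (f : K -> V)
    (x : {malg R[K]}) : V :=
  \sum_(k <- msupp x) x@_k *: f k.

Lemma linext_is_linear {K : choiceType} {V : lmodType R} (f : K -> V) :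
  linear (linext f).
Proof.
have E (d : {fset K}) x : (msupp x `<=` d)%fset ->
    linext f x = \sum_(k <- d) x@_k *: f k.
  move=> le; rewrite [LHS](big_fset_incl _ le) => //= k _ /mcoeff_outdom ->.
  by rewrite scale0r.
move=> a x y; pose d := (msupp (a *: x + y) `|` (msupp x `|` msupp y))%fset.
rewrite !(E d) ?fsubsetUl //; last 2 first.
- by rewrite /d fsetUA fsubsetUr.
- by rewrite /d fsetUCA fsubsetUl.
rewrite scaler_sumr -big_split /=; apply: eq_bigr => k _.
by rewrite mcoeffD mcoeffZ scalerDl scalerA.
Qed.

HB.instance Definition _ (K : choiceType) (V : lmodType R) (f : K -> V) :=
  GRing.isLinear.Build R {malg R[K]} V _ (linext f) (linext_is_linear f).

Lemma linextU {K : choiceType} {V : lmodType R} (f : K -> V) k :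
  linext f << k >> = f k.
Proof.
by rewrite /linext msuppU oner_eq0 big_seq_fset1 mcoeffUU scale1r.
Qed.

Lemma malg_linear_eq {K : choiceType} {V : lmodType R}
    (f g : {malg R[K]} -> V) :
  linear f -> linear g -> (forall k, f << k >> = g << k >>) -> f =1 g.
Proof.
move=> lf lg fg x.
have E (h : {malg R[K]} -> V) : linear h ->
    h x = \sum_(k <- msupp x) x@_k *: h << k >>.
  move=> lh.
  have [h' ->] : exists h' : {linear {malg R[K]} -> V}, h = h'.
    pose h' : {linear {malg R[K]} -> V} :=
      HB.pack h (GRing.isLinear.Build R {malg R[K]} V _ h lh).
    by exists h'.
  rewrite {1}[x]monalgE raddf_sum; apply: eq_bigr => k _ /=.
  have -> : << x@_k *g k >> = x@_k *: << k >> :> {malg R[K]}.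
    by apply/malgP => l; rewrite mcoeffZ !mcoeffU mulrnAr mulr1.
  by rewrite linearZ.
by rewrite (E f lf) (E g lg); apply: eq_bigr => k _; rewrite fg.
Qed.

Definition tens {K L : choiceType} (x : {malg R[K]}) (y : {malg R[L]}) :
    {malg R[(K * L)%type]} :=
  linext (fun k => linext (fun l => << (k, l) >>) y) x.

(* The linear map out of the tensor product induced by a bilinear b. *)
Definition tlift {K L : choiceType} {V : lmodType R}
    (b : {malg R[K]} -> {malg R[L]} -> V) : {malg R[(K * L)%type]} -> V :=
  linext (fun p => b << p.1 >> << p.2 >>).

HB.instance Definition _ (K L : choiceType) (V : lmodType R)
    (b : {malg R[K]} -> {malg R[L]} -> V) :=
  GRing.Linear.copy (tlift b) (linext (fun p => b << p.1 >> << p.2 >>)).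

Lemma tlift_linear {K L : choiceType} {V : lmodType R}
    (b : {malg R[K]} -> {malg R[L]} -> V) : linear (tlift b).
Proof. exact: linext_is_linear. Qed.

Definition tmap {K L K' L' : choiceType}
    (f : {malg R[K]} -> {malg R[K']}) (g : {malg R[L]} -> {malg R[L']}) :
    {malg R[(K * L)%type]} -> {malg R[(K' * L')%type]} :=
  tlift (fun x y => tens (f x) (g y)).

HB.instance Definition _ (K L K' L' : choiceType)
    (f : {malg R[K]} -> {malg R[K']}) (g : {malg R[L]} -> {malg R[L']}) :=
  GRing.Linear.copy (tmap f g) (tlift (fun x y => tens (f x) (g y))).

Definition tassoc {K L N : choiceType} :
    {malg R[((K * L) * N)%type]} -> {malg R[(K * (L * N))%type]} :=
  linext (fun p => << (p.1.1, (p.1.2, p.2)) >>).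

HB.instance Definition _ (K L N : choiceType) :=
  GRing.Linear.copy (@tassoc K L N)
    (linext (fun p => << (p.1.1, (p.1.2, p.2)) >>)).

Lemma tliftU {K L : choiceType} {V : lmodType R}
    (b : {malg R[K]} -> {malg R[L]} -> V) p :
  tlift b << p >> = b << p.1 >> << p.2 >>.
Proof. exact: linextU. Qed.

Lemma eq_tlift {K L : choiceType} {V : lmodType R}
    (b b' : {malg R[K]} -> {malg R[L]} -> V) u :
  (forall k l, b << k >> << l >> = b' << k >> << l >>) ->
  tlift b u = tlift b' u.
Proof.
by move=> E; rewrite /tlift /linext; apply: eq_bigr => p _; rewrite E.
Qed.

Lemma linear_tlift {K L : choiceType} {V W : lmodType R} (g : V -> W)
    (b : {malg R[K]} -> {malg R[L]} -> V) u : linear g ->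
  g (tlift b u) = tlift (fun x y => g (b x y)) u.
Proof.
move=> lg; move: u; apply: malg_linear_eq => [a u v|a u v|p].
- by rewrite tlift_linear lg.
- exact: tlift_linear.
- by rewrite !tliftU.
Qed.

Lemma tens_linearl {K L : choiceType} (y : {malg R[L]}) :
  linear (fun x : {malg R[K]} => tens x y).
Proof. by move=> a x x'; rewrite /tens linearP. Qed.

Lemma tens_linearr {K L : choiceType} (x : {malg R[K]}) :
  linear (fun y : {malg R[L]} => tens x y).
Proof.
move=> a y y'; rewrite /tens /linext scaler_sumr -big_split /=.
apply: eq_bigr => k _; rewrite -/(linext _ _) linearP scalerDr !scalerA.
by rewrite mulrC.
Qed.

Lemma mcoeff_tens {K L : choiceType} (x : {malg R[K]}) (y : {malg R[L]}) p :
  (tens x y)@_p = x@_p.1 * y@_p.2.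
Proof.
move: x.
apply: (@malg_linear_eq _ R^o (fun x => (tens x y)@_p)) => [a u v|a u v|k].
- by rewrite tens_linearl mcoeffD mcoeffZ.
- by rewrite mcoeffD mcoeffZ mulrDl -mulrA.
move: y.
apply: (@malg_linear_eq _ R^o (fun y => (tens _ y)@_p)) => [a u v|a u v|l].
- by rewrite tens_linearr mcoeffD mcoeffZ.
- by rewrite mcoeffD mcoeffZ mulrDr mulrCA.
by rewrite /tens !linextU !mcoeffU; case: p => i j; rewrite -natrM mulnb.
Qed.

Lemma mcoeff_tassoc {K L N : choiceType} (u : {malg R[((K * L) * N)%type]})
    k l n : (tassoc u)@_(k, (l, n)) = u@_((k, l), n).
Proof.
move: u.
apply: (@malg_linear_eq _ R^o (fun u => (tassoc u)@_(k, (l, n)))).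
- by move=> a u v; rewrite linearP mcoeffD mcoeffZ.
- by move=> a u v; rewrite mcoeffD mcoeffZ.
case=> -[i j] m; rewrite /tassoc linextU !mcoeffU.
by rewrite -!pair_eqE /= -!pair_eqE /= andbA.
Qed.

Lemma tlift_tens {K L : choiceType} {V : lmodType R}
    (b : {malg R[K]} -> {malg R[L]} -> V) x y :
  (forall y, linear (fun x => b x y)) -> (forall x, linear (b x)) ->
  tlift b (tens x y) = b x y.
Proof.
move=> ll lr; move: x; apply: malg_linear_eq => [a u v||k] //.
  by rewrite tens_linearl linearP.
move: y; apply: malg_linear_eq => [a u v||l] //.
  by rewrite tens_linearr linearP.
by rewrite /tens !linextU tliftU.
Qed.

Lemma tlift_tmap {K L K' L' : choiceType} {V : lmodType R}
    (b : {malg R[K']} -> {malg R[L']} -> V)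
    (f : {malg R[K]} -> {malg R[K']}) (g : {malg R[L]} -> {malg R[L']}) u :
  (forall y, linear (fun x => b x y)) -> (forall x, linear (b x)) ->
  tlift b (tmap f g u) = tlift (fun x y => b (f x) (g y)) u.
Proof.
move=> ll lr; move: u; apply: malg_linear_eq => [a u v|a u v|p].
- by rewrite !linearP.
- by rewrite linearP.
- by rewrite /tmap !tliftU tlift_tens.
Qed.

(* (x (x) y)(x' (x) y') = mul x x' (x) mul y y' *)
Definition tmul {K : choiceType}
    (mul : {malg R[K]} -> {malg R[K]} -> {malg R[K]})
    (u v : {malg R[(K * K)%type]}) : {malg R[(K * K)%type]} :=
  tlift (fun x y => tlift (fun x' y' => tens (mul x x') (mul y y')) v) u.

End FreeModules.

Section Hopf.
Context {R : realType} {K : choiceType}.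
Local Notation H := {malg R[K]}.

(* The antipode is not part of the data: it is unique when it exists. *)
Record hopf_data := HopfData {
  hmul : H -> H -> H;
  hunit : H;
  hcomul : H -> {malg R[(K * K)%type]};
  hcounit : H -> R^o }.

Definition is_antipode (D : hopf_data) (S : H -> H) : Prop :=
  linear S /\
  forall x,
    tlift (fun y z => hmul D (S y) z) (hcomul D x) = hcounit D x *: hunit D /\
    tlift (fun y z => hmul D y (S z)) (hcomul D x) = hcounit D x *: hunit D.

Record is_hopf_algebra (D : hopf_data) : Prop := IsHopfAlgebra {
  hmul_linearl : forall y, linear (fun x => hmul D x y);
  hmul_linearr : forall x, linear (hmul D x);
  hmulA : associative (hmul D);
  hmul1l : left_id (hunit D) (hmul D);
  hmul1r : right_id (hunit D) (hmul D);
  hcomul_linear : linear (hcomul D);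
  hcounit_linear : linear (hcounit D);
  hcomulA : forall x,
    tassoc (tmap (hcomul D) id (hcomul D x)) = tmap id (hcomul D) (hcomul D x);
  hcounitl : forall x, tlift (fun y z => hcounit D y *: z) (hcomul D x) = x;
  hcounitr : forall x, tlift (fun y z => hcounit D z *: y) (hcomul D x) = x;
  hcomulM : forall x y,
    hcomul D (hmul D x y) = tmul (hmul D) (hcomul D x) (hcomul D y);
  hcomul1 : hcomul D (hunit D) = tens (hunit D) (hunit D);
  hcounitM : forall x y, hcounit D (hmul D x y) = hcounit D x * hcounit D y;
  hcounit1 : hcounit D (hunit D) = 1;
  hantipode : exists S, is_antipode D S }.

Record is_hopf_isomorphism (D E : hopf_data) (f : H -> H) : Prop :=
  IsHopfIsomorphism {
  hiso_source : is_hopf_algebra D;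
  hiso_target : is_hopf_algebra E;
  hiso_linear : linear f;
  hiso_bij : bijective f;
  hiso_mul : forall x y, f (hmul D x y) = hmul E (f x) (f y);
  hiso_unit : f (hunit D) = hunit E;
  hiso_comul : forall x, hcomul E (f x) = tmap f f (hcomul D x);
  hiso_counit : forall x, hcounit E (f x) = hcounit D x;
  hiso_antipode : forall S T, is_antipode D S -> is_antipode E T ->
    forall x, f (S x) = T (f x) }.

End Hopf.
Arguments hopf_data : clear implicits.

(* {cmonom I} is the monoid of finitely supported functions I -> nat, written
   multiplicatively: mmul adds functions and mone is the zero function.  Hence
   1 = << mone >> and x * y in {malg R[{cmonom I}]} are the unit and product
   of its monoid algebra. *)

Section MultisetAlgebra.
Context {R : realType} {I : choiceType}.
Local Notation M := {cmonom I}.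
Local Notation H := {malg R[{cmonom I}]}.
Implicit Types A B : {cmonom I}.

(* The factors with a outside finsupp A are 1 when mmul B1 B2 = A. *)
Definition mbinom A B1 B2 : R :=
  if mmul B1 B2 == A then
    \prod_(a <- finsupp A) ((A a)`!%:R / ((B1 a)`!%:R * (B2 a)`!%:R))
  else 0.

(* The summand vanishes outside the finite set of pairs with product A, see
   finite_splits. *)
Definition comul : H -> {malg R[(M * M)%type]} :=
  linext (fun A => \sum_(p \in [set: M * M]) mbinom A p.1 p.2 *: << p >>).

HB.instance Definition _ := GRing.Linear.copy comul
  (linext (fun A => \sum_(p \in [set: M * M]) mbinom A p.1 p.2 *: << p >>)).

Definition counit : H -> R^o := linext (fun A => (A == mone)%:R : R^o).

HB.instance Definition _ :=
  GRing.Linear.copy counit (linext (fun A => (A == mone)%:R : R^o)).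

Definition star (f g : H -> R^o) : H -> R^o :=
  fun x => tlift (fun y z => f y * g z : R^o) (comul x).

(* The solution u of
     b A = \sum_(p \in setT) mbinom A p.1 p.2 *: (l p.1 *: u p.2),
   for l mone = 1, by recursion on mdeg A; see deconvE. *)
Fixpoint deconv_rec {V : lmodType R} (l : M -> R) (b : M -> V) (n : nat) A : V :=
  if n is n'.+1 then
    b A - \sum_(p \in [set p : M * M | p.1 != mone])
            mbinom A p.1 p.2 *: (l p.1 *: deconv_rec l b n' p.2)
  else 0.

Definition deconv {V : lmodType R} (l : M -> R) (b : M -> V) A : V :=
  deconv_rec l b (mdeg A).+1 A.

Lemma finite_splits A : finite_set [set p : M * M | mmul p.1 p.2 = A].
Proof.
pose mk (f : {ffun finsupp A -> 'I_(mdeg A).+1}) : M :=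
  [cmonom f a : nat | a : finsupp A]%M.
apply: (@sub_finite_set _ _ ((fun f => (mk f.1, mk f.2)) @` [set: _])); last first.
  by apply: finite_image; exact: finite_finset.
have le B1 B2 : mmul B1 B2 = A -> exists f, mk f = B1.
  move=> E; have le a : (B1 a <= A a)%N by rewrite -E cmM leq_addr.
  have led (a : finsupp A) : (B1 (val a) < (mdeg A).+1)%N.
    rewrite ltnS (leq_trans (le _)) // mdegE (big_fsetD1 (val a)) ?leq_addr //=.
  exists [ffun a => Ordinal (led a)]; apply/eqP/cmP => a.
  rewrite cmE fsfun_ffun; case: insubP => [u ua Eu|] /=.
    by rewrite ffunE /= Eu.
  by rewrite -cmE_eq0 => /eqP A0; have := le a; rewrite A0 leqn0 => /eqP.
move=> [B1 B2] /= E; have [f1 E1] := le _ _ E.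
have [|f2 E2] := le B2 B1; first by rewrite mulmC.
by exists (f1, f2) => //=; rewrite E1 E2.
Qed.

Definition splits A : {fset M * M} := fset_set [set p : M * M | mmul p.1 p.2 = A].

Lemma in_splits A p : (p \in splits A) = (mmul p.1 p.2 == A).
Proof.
rewrite /splits in_fset_set; last exact: finite_splits.
by apply/idP/eqP; rewrite inE.
Qed.

Lemma sum_mbinomE {V : lmodType R} A (P : pred (M * M)) (F : M * M -> V) :
  \sum_(p \in [set p | P p]) mbinom A p.1 p.2 *: F p =
  \sum_(p <- splits A | P p) mbinom A p.1 p.2 *: F p.
Proof.
rewrite (@fsbigE _ 0 _ _ _ [seq p <- splits A | P p]).
- rewrite big_filter_cond; apply: eq_bigl => p.
  by apply/andP/idP => [[]//|Pp]; rewrite Pp; split=> //; rewrite inE.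
- by apply: filter_uniq; exact: fset_uniq.
- by move=> p /=; rewrite mem_filter => /andP[].
- move=> p /= Pp; rewrite mem_filter Pp in_splits /= /mbinom => /negbTE ->.
  by rewrite scale0r.
Qed.

Lemma sum_mbinomTE {V : lmodType R} A (F : M * M -> V) :
  \sum_(p \in [set: M * M]) mbinom A p.1 p.2 *: F p =
  \sum_(p <- splits A) mbinom A p.1 p.2 *: F p.
Proof.
by rewrite -sum_mbinomE; apply: eq_fsbigl; apply/seteqP; split.
Qed.

Lemma mcoeff_comul A p : (comul << A >>)@_p = mbinom A p.1 p.2.
Proof.
rewrite /comul linextU sum_mbinomTE raddf_sum /=.
under eq_bigr => q _ do rewrite mcoeffZ mcoeffU.
have [pA|pA] := boolP (p \in splits A).
  rewrite (big_fsetD1 p pA) /=.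
  rewrite eqxx mulr1 big1_seq ?addr0 // => q /=.
  by rewrite in_fsetD1 => /andP[/negbTE-> _]; rewrite mulr0.
rewrite big1_seq => [|q /= qA].
  by move: pA; rewrite in_splits /mbinom => /negbTE ->.
by case: eqP qA pA => [->->//|]; rewrite mulr0.
Qed.

Lemma tlift_comulU {V : lmodType R} (b : H -> H -> V) A :
  tlift b (comul << A >>) =
  \sum_(p \in [set: M * M]) mbinom A p.1 p.2 *: b << p.1 >> << p.2 >>.
Proof.
rewrite /tlift /comul linextU !sum_mbinomTE raddf_sum; apply: eq_bigr => p _ /=.
by rewrite linearZ /= linextU.
Qed.

Lemma mbinom1l A : mbinom A mone A = 1.
Proof.
rewrite /mbinom mul1m eqxx big1 // => a _.
by rewrite cm1 fact0 mul1r divff // pnatr_eq0 -lt0n fact_gt0.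
Qed.

Lemma mbinomC A B1 B2 : mbinom A B1 B2 = mbinom A B2 B1.
Proof.
by rewrite /mbinom mulmC; case: ifP => // _; apply: eq_bigr => a _; rewrite [X in _ / X]mulrC.
Qed.


Lemma deconv_recE {V : lmodType R} (l : M -> R) (b : M -> V) n A :
  (mdeg A < n)%N -> deconv_rec l b n A = deconv l b A.
Proof.
elim: n {-2}n (leqnn n) A => [|N IH] [|n] //= nN A An; rewrite /deconv /=.
congr (_ - _); rewrite !(sum_mbinomE _ (fun p => p.1 != mone)).
rewrite big_seq_cond [RHS]big_seq_cond; apply: eq_bigr => p /andP[].
rewrite in_splits => /eqP E p1.
have dp : (mdeg p.2 < mdeg A)%N.
  by rewrite -E mdegM -[X in (X < _)%N]add0n ltn_add2r lt0n mdeg_eq0.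
rewrite (IH n) //; last exact: leq_trans dp _.
rewrite (IH (mdeg A)) //; move: An nN; rewrite !ltnS; exact: leq_trans.
Qed.

Lemma deconvE {V : lmodType R} (l : M -> R) (b : M -> V) A : l mone = 1 ->
  b A = \sum_(p \in [set: M * M]) mbinom A p.1 p.2 *: (l p.1 *: deconv l b p.2).
Proof.
move=> l1; rewrite sum_mbinomTE (bigID (fun p => p.1 != mone)) /=.
rewrite [X in _ + X](_ : _ = deconv l b A); last first.
  rewrite big_mkcond (bigD1_seq (mone, A)) ?in_splits ?mul1m ?fset_uniq //=.
  rewrite eqxx /= mbinom1l l1 !scale1r big1_seq ?addr0 // => -[B1 B2] /=.
  rewrite in_splits /= => /andP[ne /eqP E]; case: eqP => //= B11.
  by rewrite B11 mul1m in E; rewrite B11 E eqxx in ne.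
rewrite {2}/deconv /= (sum_mbinomE _ (fun p => p.1 != mone)) addrC.
rewrite [X in _ - X](_ : _ = \sum_(p <- splits A | p.1 != mone)
   mbinom A p.1 p.2 *: (l p.1 *: deconv l b p.2)) ?subrK //.
rewrite big_seq_cond [RHS]big_seq_cond; apply: eq_bigr => p /andP[].
rewrite in_splits => /eqP E p1; rewrite deconv_recE //.
by rewrite -E mdegM -[X in (X < _)%N]add0n ltn_add2r lt0n mdeg_eq0.
Qed.

Lemma mbinom_assoc A B1 B2 B3 :
  mbinom A (mmul B1 B2) B3 * mbinom (mmul B1 B2) B1 B2 =
  mbinom A B1 (mmul B2 B3) * mbinom (mmul B2 B3) B2 B3.
Proof.
have prodE (B C D : M) : (finsupp (mmul C D) `<=` finsupp B)%fset ->
    mbinom (mmul C D) C D =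
    \prod_(a <- finsupp B) (((C a + D a)%N)`!%:R / ((C a)`!%:R * (D a)`!%:R)).
  move=> le; rewrite /mbinom eqxx (big_fset_incl _ le) => [|a _].
    by apply: eq_bigr => a _; rewrite cmM.
  rewrite -cmE_eq0 cmM addn_eq0 => /andP[/eqP-> /eqP->].
  by rewrite fact0 mulr1 divr1.
have [E|NE] := eqVneq (mmul B1 (mmul B2 B3)) A; last first.
  rewrite {1}/mbinom -mulmA (negbTE NE) mul0r.
  by rewrite /mbinom (negbTE NE) mul0r.
have E' : mmul (mmul B1 B2) B3 = A by rewrite -mulmA.
have le1 : (finsupp (mmul B1 B2) `<=` finsupp A)%fset.
  by rewrite -E' [in X in (_ `<=` X)%fset]mdomD fsubsetUl.
have le2 : (finsupp (mmul B2 B3) `<=` finsupp A)%fset.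
  by rewrite -E [in X in (_ `<=` X)%fset]mdomD fsubsetUr.
rewrite (prodE A B1 B2) // (prodE A B2 B3) //.
have := prodE A (mmul B1 B2) B3; rewrite E' => -> //.
have := prodE A B1 (mmul B2 B3); rewrite E => -> //.
rewrite -!big_split /=; apply: eq_bigr => a _; rewrite !cmM addnA.
have nz n : n`!%:R != 0 :> R by rewrite pnatr_eq0 -lt0n fact_gt0.
by field; rewrite !nz.
Qed.

Lemma sum_mbinom1 {V : lmodType R} A p (F : M * M -> V) :
  (forall q, mmul q.1 q.2 = A -> q != p -> F q = 0) ->
  \sum_(q \in [set: M * M]) mbinom A q.1 q.2 *: F q = mbinom A p.1 p.2 *: F p.
Proof.
move=> F0; rewrite sum_mbinomTE.
have [pA|pA] := boolP (p \in splits A).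
  rewrite (big_fsetD1 p pA) /= big1_seq ?addr0 // => q /=.
  rewrite in_fsetD1 in_splits => /andP[ne /eqP/F0-> //]; exact: scaler0.
rewrite big1_seq => [|q /= qA].
  by move: pA; rewrite in_splits /mbinom => /negbTE ->; rewrite scale0r.
rewrite F0 ?scaler0 //; first by move: qA; rewrite in_splits => /eqP.
by apply: contraNneq pA => <-.
Qed.

Lemma mcoeff_sum {K : choiceType} A (F : M * M -> {malg R[K]}) k :
  (\sum_(p \in [set: M * M]) mbinom A p.1 p.2 *: F p)@_k =
  \sum_(p \in [set: M * M]) mbinom A p.1 p.2 *: ((F p)@_k : R^o).
Proof.
rewrite !sum_mbinomTE raddf_sum; apply: eq_bigr => p _ /=.
by rewrite mcoeffZ.
Qed.

Lemma comulA x : tassoc (tmap comul id (comul x)) = tmap id comul (comul x).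
Proof.
move: x; apply: malg_linear_eq => [a u v|a u v|A].
- by rewrite !linearP.
- by rewrite !linearP.
apply/malgP => -[B1 [B2 B3]].
rewrite mcoeff_tassoc /tmap !tlift_comulU !mcoeff_sum.
rewrite (@sum_mbinom1 _ _ (mmul B1 B2, B3)); last first.
  move=> [C1 C2] _ ne; rewrite mcoeff_tens mcoeff_comul mcoeffU /=.
  rewrite /mbinom; case: eqP => [E|]; rewrite ?mul0r //.
  by case: eqP => [E'|]; rewrite ?mulr0 //; rewrite E E' eqxx in ne.
rewrite (@sum_mbinom1 _ _ (B1, mmul B2 B3)); last first.
  move=> [C1 C2] _ ne; rewrite mcoeff_tens mcoeff_comul mcoeffU /=.
  rewrite /mbinom mulrC; case: eqP => [E|]; rewrite ?mul0r //.
  by case: eqP => [E'|]; rewrite ?mulr0 //; rewrite E E' eqxx in ne.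
rewrite !mcoeff_tens !mcoeff_comul !mcoeffU !eqxx /= mul1r mulr1.
exact: mbinom_assoc.
Qed.

Lemma comul_swap {V : lmodType R} (b : H -> H -> V) x :
  tlift b (comul x) = tlift (fun y z => b z y) (comul x).
Proof.
move: x; apply: malg_linear_eq => [a u v|a u v|A].
- by rewrite !linearP.
- by rewrite !linearP.
rewrite !tlift_comulU [LHS](@reindex_fsbigT _ _ _ _ _ (fun p : M * M => (p.2, p.1))) /=; last first.
  by exists (fun p => (p.2, p.1)) => -[].
by apply: eq_fsbigr => p _; rewrite mbinomC.
Qed.

Lemma counit_comul {V : lmodType R} (f : H -> V) x : linear f ->
  tlift (fun y z => counit y *: f z) (comul x) = f x.
Proof.
move=> lf; move: x; apply: malg_linear_eq => [a u v|//|A].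
  by rewrite !linearP.
rewrite tlift_comulU (@sum_mbinom1 _ _ (mone, A)) /=.
  by rewrite mbinom1l /counit linextU eqxx !scale1r.
move=> [B1 B2] /= E ne; rewrite /counit linextU /=.
case: eqVneq => [B11|_]; last by rewrite scale0r.
by rewrite B11 mul1m in E; rewrite B11 E eqxx in ne.
Qed.

End MultisetAlgebra.

Section UnitalForms.
Context (R : realType) (I : choiceType).
Local Notation M := {cmonom I}.
Local Notation H := {malg R[{cmonom I}]}.

(* The set G(H) of linear forms on H with value 1 at the unit; it is a group for
   the convolution star, with unit counit. *)
Record unital_form := UnitalForm {
  uform :> H -> R^o;
  uform_linear : linear uform;
  uform1 : uform 1 = 1 }.

HB.instance Definition _ (l : unital_form) :=
  GRing.isLinear.Build R H R^o _ (uform l) (uform_linear l).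

HB.instance Definition _ := gen_eqMixin unital_form.
HB.instance Definition _ := gen_choiceMixin unital_form.

Lemma unital_formP (l n : unital_form) :
  (forall A, l << A >> = n << A >>) -> l = n.
Proof.
move=> ln; have : uform l = uform n.
  by apply/funext; apply: malg_linear_eq => //; exact: uform_linear.
case: l n {ln} => f lf f1 [g lg g1] /= fg; rewrite fg in lf f1 *.
by congr UnitalForm; exact: Prop_irrelevance.
Qed.

Lemma counit1 : counit (1 : H) = 1 :> R^o.
Proof. by rewrite /counit linextU eqxx. Qed.

Definition unital_counit : unital_form :=
  @UnitalForm (@counit R I) (linext_is_linear _) counit1.

Lemma star_linear (f g : H -> R^o) : linear (star f g).
Proof. by move=> a x y; rewrite /star !linearP. Qed.

Lemma star1 (l n : unital_form) : star l n 1 = 1.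
Proof.
rewrite /star tlift_comulU (@sum_mbinom1 _ _ _ _ (mone, mone)) /=.
  by rewrite mbinom1l !uform1 mulr1 scale1r.
by move=> [B1 B2] /= /unitm[-> ->]; rewrite eqxx.
Qed.

Definition unital_star (l n : unital_form) : unital_form :=
  UnitalForm (star_linear l n) (star1 l n).

Definition inv_form (l : unital_form) : H -> R^o :=
  linext (deconv (fun A => l << A >>) (fun A => (A == mone)%:R : R^o)).

Lemma star_inv_form (l : unital_form) x : star l (inv_form l) x = counit x.
Proof.
move: x; apply: malg_linear_eq => [a u v|a u v|A].
- exact: star_linear.
- by rewrite linearP.
rewrite /star tlift_comulU /counit linextU.
have l1 : l << mone >> = 1 by rewrite -[<< _ >>]mpolyC1E uform1.
have -> := @deconvE _ _ R^o (fun A => l << A >>)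
  (fun A => (A == mone)%:R : R^o) A l1.
by apply: eq_fsbigr => p _; rewrite /inv_form linextU.
Qed.

Lemma inv_form1 (l : unital_form) : inv_form l 1 = 1.
Proof.
rewrite -[RHS]counit1 -(star_inv_form l) /star tlift_comulU.
rewrite (@sum_mbinom1 _ _ _ _ (mone, mone)) /=.
  by rewrite mbinom1l uform1 mul1r scale1r.
by move=> [B1 B2] /= /unitm[-> ->]; rewrite eqxx.
Qed.

Definition unital_inv (l : unital_form) : unital_form :=
  @UnitalForm (inv_form l) (linext_is_linear _) (inv_form1 l).

Lemma unital_starC : commutative unital_star.
Proof.
move=> l n; apply: unital_formP => A.
transitivity (tlift (fun y z => l z * n y : R^o) (comul << A >>)).
  exact: (comul_swap (fun y z => l y * n z : R^o)).
by apply: eq_tlift => j k; exact: mulrC.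
Qed.

Lemma unital_starA : associative unital_star.
Proof.
move=> l n m; apply: unital_formP => A.
pose b1 (x : H) v : R^o := l x * tlift (fun y z => n y * m z : R^o) v.
pose b2 u (z : H) : R^o := tlift (fun x y => l x * n y : R^o) u * m z.
have b1l v : linear (fun x => b1 x v).
  by move=> a x y; rewrite /b1 linearP mulrDl -scalerAl.
have b1r x : linear (b1 x).
  by move=> a u v; rewrite /b1 linearP mulrDr -scalerAr.
have b2l z : linear (fun u => b2 u z).
  by move=> a u v; rewrite /b2 linearP mulrDl -scalerAl.
have b2r u : linear (b2 u).
  by move=> a y z; rewrite /b2 linearP mulrDr -scalerAr.
transitivity (tlift b1 (tmap id comul (comul << A >>))).
  by rewrite (tlift_tmap _ _ _ b1l b1r).
transitivity (tlift b2 (tmap comul id (comul << A >>))); last first.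
  by rewrite (tlift_tmap _ _ _ b2l b2r).
rewrite -comulA; move: (tmap comul id _).
apply: malg_linear_eq => [a u v|a u v|p].
- by rewrite !linearP.
- by rewrite linearP.
- by rewrite /tassoc linextU !tliftU /b1 /b2 !tliftU /= mulrA.
Qed.

Lemma unital_star1l : left_id unital_counit unital_star.
Proof.
move=> l; apply: unital_formP => A /=; rewrite /star.
exact: (@counit_comul _ _ R^o l << A >> (uform_linear l)).
Qed.

Lemma unital_starVl : left_inverse unital_counit unital_inv unital_star.
Proof.
move=> l; rewrite unital_starC; apply: unital_formP => A /=.
exact: star_inv_form.
Qed.

Lemma unital_star1r : right_id unital_counit unital_star.
Proof. by move=> l; rewrite unital_starC unital_star1l. Qed.

Lemma unital_starVr : right_inverse unital_counit unital_inv unital_star.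
Proof. by move=> l; rewrite unital_starC unital_starVl. Qed.

HB.instance Definition _ := isGroup.Build unital_form
  unital_starA unital_star1l unital_star1r unital_starVl unital_starVr.

End UnitalForms.

Section Deformation.
Context {R : realType} {I : choiceType}.
Local Notation H := {malg R[{cmonom I}]}.
Implicit Types l n : unital_form R I.

Definition phi l : H -> H := fun x => tlift (fun y z => l y *: z) (comul x).

Lemma phi_linear l : linear (phi l).
Proof. by move=> a x y; rewrite /phi !linearP. Qed.

HB.instance Definition _ l :=
  GRing.isLinear.Build R H H _ (phi l) (phi_linear l).

Lemma phi_counit x : phi 1%g x = x.
Proof. exact: (@counit_comul _ _ _ id). Qed.

Lemma phi_comp l n x : phi l (phi n x) = phi (n * l)%g x.
Proof.
pose b1 (y : H) v : H := n y *: tlift (fun z w => l z *: w) v.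
pose b2 u (w : H) : H := tlift (fun y z => n y * l z : R^o) u *: w.
have b1l v : linear (fun y => b1 y v).
  by move=> a y z; rewrite /b1 linearP scalerDl scalerA.
have b1r y : linear (b1 y).
  by move=> a u v; rewrite /b1 linearP scalerDr !scalerA mulrC.
have b2l w : linear (fun u => b2 u w).
  by move=> a u v; rewrite /b2 linearP scalerDl scalerA.
have b2r u : linear (b2 u).
  by move=> a y z; rewrite /b2 scalerDr !scalerA mulrC.
transitivity (tlift b1 (tmap id comul (comul x))).
  rewrite (tlift_tmap _ _ _ b1l b1r) /b1 {2}/phi; move: (comul x).
  apply: malg_linear_eq => [a u v|a u v|p].
  - by rewrite linearP phi_linear.
  - exact: tlift_linear.
  - transitivity (phi l (n << p.1 >> *: << p.2 >>)).
      by rewrite tliftU.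
    rewrite (GRing.scalable_linear (phi_linear l)).
    by rewrite [RHS]tliftU.
transitivity (tlift b2 (tmap comul id (comul x))); last first.
  by rewrite (tlift_tmap _ _ _ b2l b2r).
rewrite -comulA; move: (tmap comul id _).
apply: malg_linear_eq => [a u v|a u v|p].
- by rewrite !linearP.
- exact: tlift_linear.
- by rewrite /tassoc linextU !tliftU /b1 /b2 !tliftU scalerA.
Qed.

Lemma phiK l : cancel (phi l) (phi l^-1%g).
Proof. by move=> x; rewrite phi_comp mulgV phi_counit. Qed.

Lemma phiVK l : cancel (phi l^-1%g) (phi l).
Proof. by move=> x; rewrite phi_comp mulVg phi_counit. Qed.

Definition deformed_mul l (x y : H) : H := phi l^-1%g (phi l x * phi l y).

Definition deformed_comul l (x : H) : {malg R[({cmonom I} * {cmonom I})%type]} :=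
  tmap (phi l^-1%g) (phi l^-1%g) (comul (phi l x)).

Definition deformed_counit l (x : H) : R^o := counit (phi l x).

Lemma deformed_counitE l : deformed_counit l =1 l.
Proof.
move=> x; rewrite /deformed_counit /phi.
rewrite (linear_tlift _ _ (linext_is_linear _ : linear (@counit R I))).
rewrite -[RHS](@counit_comul _ _ R^o l x (uform_linear l)) [RHS]comul_swap.
apply: eq_tlift => j k.
rewrite (GRing.scalable_linear (linext_is_linear _ : linear (@counit R I))).
exact: mulrC.
Qed.

Definition multiset_hopf : hopf_data R {cmonom I} :=
  HopfData *%R 1 comul counit.

Definition deformed_hopf l : hopf_data R {cmonom I} :=
  HopfData (deformed_mul l) 1 (deformed_comul l) (deformed_counit l).

End Deformation.

Section Wick.
Context {R : realType} {d : measure_display} {T : measurableType d}.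
Context {P : probability T R} {I : choiceType}.
Variable X : I -> {RV P >-> R}.
Implicit Types A B : {cmonom I}.
Local Notation H := {malg R[{cmonom I}]}.

Definition rv_monomial B : T -> R :=
  fun w => \prod_(a <- finsupp B) X a w ^+ B a.

(* A finite expectation as soon as all the X a have moments of all orders. *)
Definition moment B : R := fine 'E_P[rv_monomial B].

Lemma moment1 : linext (moment : {cmonom I} -> R^o) 1 = 1.
Proof.
rewrite -mpolyC1E linextU /moment.
rewrite (_ : rv_monomial mone = cst 1) ?expectation_cst //.
by apply/funext => w; rewrite /rv_monomial mdom1 big_seq_fset0.
Qed.

Definition moment_form : unital_form R I :=
  @UnitalForm R I (linext (moment : {cmonom I} -> R^o))
    (linext_is_linear _) moment1.

Definition wick : H -> H := linext (deconv moment (fun A => << A >>)).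

Lemma moment_mone : moment mone = 1.
Proof. by rewrite -moment1 -mpolyC1E linextU. Qed.

(* The recursion defining the Wick product map. *)
Lemma wick_rec A :
  << A >> = \sum_(p \in [set: {cmonom I} * {cmonom I}])
    mbinom A p.1 p.2 *: (moment p.1 *: wick << p.2 >>).
Proof.
rewrite (@deconvE _ _ _ moment (fun A => << A >>) A moment_mone).
by apply: eq_fsbigr => p _; rewrite /wick linextU.
Qed.

Lemma wick_mone : wick << mone >> = << mone >>.
Proof.
rewrite [RHS]wick_rec (@sum_mbinom1 _ _ _ _ (mone, mone)) /=.
  by rewrite mbinom1l moment_mone !scale1r.
by move=> [B1 B2] /= /unitm[-> ->]; rewrite eqxx.
Qed.

End Wick.

(* Main.v *)
(* Read through phi_mu, the recursion defining the Wick map says that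
   W (phi_mu A) = A for every basis vector A, so W is the inverse of phi_mu,
   which is phi_{mu^-1}.  The deformed structure is by definition the image of
   the original one under phi_mu^-1, and a Hopf algebra structure can be carried
   along any linear bijection; antipodes correspond because they are unique.
   That H itself is a Hopf algebra rests on the multiplicativity of the
   coproduct, proved by adding one variable a at a time: Pascal's rule for the
   multinomials says Delta (a A) = (a (x) 1 + 1 (x) a) Delta A. *)

Require Import Defs.
From mathcomp Require Import all_boot all_order all_algebra.
From mathcomp Require Import finmap monalg.
From mathcomp Require Import all_classical all_reals all_analysis.
Import Order.TTheory GRing.Theory Num.Theory.
Local Open Scope ring_scope.

(** * Linear maps on tensor products of free modules *)

Section Tensor.
Set Implicit Arguments.
Unset Strict Implicit.
Context {R : realType}.

Lemma tmap_linear {K L K' L' : choiceType}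
    (f : {malg R[K]} -> {malg R[K']}) (g : {malg R[L]} -> {malg R[L']}) :
  linear (tmap f g).
Proof. exact: linext_is_linear. Qed.

Lemma linear_comp {U V W : lmodType R} (f : V -> W) (g : U -> V) :
  linear f -> linear g -> linear (f \o g).
Proof. by move=> lf lg a x y /=; rewrite lg lf. Qed.

Lemma linear_combination {V W : lmodType R} (a : R) (f g : V -> W) :
  linear f -> linear g -> linear (fun x => a *: f x + g x).
Proof.
by move=> lf lg b x y; rewrite lf lg !scalerDr !scalerA (mulrC a) addrACA.
Qed.

Lemma tliftD {K L : choiceType} {V : lmodType R}
    (b b' : {malg R[K]} -> {malg R[L]} -> V) u :
  tlift (fun x y => b x y + b' x y) u = tlift b u + tlift b' u.
Proof.
by rewrite /tlift /linext -big_split; apply: eq_bigr => p _; rewrite scalerDr.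
Qed.

Lemma tmap_tens {K L K' L' : choiceType}
    (f : {malg R[K]} -> {malg R[K']}) (g : {malg R[L]} -> {malg R[L']}) x y :
  linear f -> linear g -> tmap f g (tens x y) = tens (f x) (g y).
Proof.
move=> lf lg; rewrite /tmap tlift_tens // => [z a u v|z a u v].
- by rewrite lf tens_linearl.
- by rewrite lg tens_linearr.
Qed.

Lemma tensU {K L : choiceType} (k : K) (l : L) :
  tens << k >> << l >> = << (k, l) >> :> {malg R[(K * L)%type]}.
Proof. by rewrite /tens !linextU. Qed.

Lemma tmapU {K L K' L' : choiceType}
    (f : {malg R[K]} -> {malg R[K']}) (g : {malg R[L]} -> {malg R[L']}) p :
  tmap f g << p >> = tens (f << p.1 >>) (g << p.2 >>).
Proof. exact: tliftU. Qed.

Lemma tmap_comp {K L K' L' K'' L'' : choiceType}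
    (f : {malg R[K']} -> {malg R[K'']}) (g : {malg R[L']} -> {malg R[L'']})
    (f' : {malg R[K]} -> {malg R[K']}) (g' : {malg R[L]} -> {malg R[L']}) u :
  linear f -> linear g ->
  tmap f g (tmap f' g' u) = tmap (f \o f') (g \o g') u.
Proof.
move=> lf lg; rewrite {1}/tmap tlift_tmap // => [z a x y|z a x y].
- by rewrite lf tens_linearl.
- by rewrite lg tens_linearr.
Qed.

Lemma eq_tmap {K L K' L' : choiceType}
    (f f' : {malg R[K]} -> {malg R[K']}) (g g' : {malg R[L]} -> {malg R[L']}) :
  f =1 f' -> g =1 g' -> tmap f g =1 tmap f' g'.
Proof. by move=> E E' u; apply: eq_tlift => k l; rewrite E E'. Qed.

Lemma tmap_id {K L : choiceType} (u : {malg R[(K * L)%type]}) :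
  tmap id id u = u.
Proof.
move: u; apply: malg_linear_eq => [||[k l]] //; first exact: tmap_linear.
by rewrite tmapU tensU.
Qed.

Lemma tassoc_linear {K L N : choiceType} : linear (@tassoc R K L N).
Proof. exact: linext_is_linear. Qed.

Lemma tassoc_tens {K L N : choiceType} (x : {malg R[K]}) (y : {malg R[L]})
    (z : {malg R[N]}) :
  tassoc (tens (tens x y) z) = tens x (tens y z).
Proof.
by apply/malgP => -[k [l n]]; rewrite mcoeff_tassoc !mcoeff_tens /= mulrA.
Qed.

(** Naturality of the associator; it lets coassociativity be carried along a linear bijection. *)
Lemma tassoc_tmap {K L N K' L' N' : choiceType}
    (f : {malg R[K]} -> {malg R[K']}) (g : {malg R[L]} -> {malg R[L']})
    (h : {malg R[N]} -> {malg R[N']}) u :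
  tassoc (tmap (tmap f g) h u) = tmap f (tmap g h) (tassoc u).
Proof.
move: u; apply: malg_linear_eq => [||[[k l] n]].
- exact: (linear_comp tassoc_linear (tmap_linear _ _)).
- exact: (linear_comp (tmap_linear _ _) tassoc_linear).
by rewrite [tassoc << _ >>]linextU !tmapU tassoc_tens.
Qed.

Section BilinearProduct.
Context {K : choiceType} (mul : {malg R[K]} -> {malg R[K]} -> {malg R[K]}).
Hypotheses (mull : forall y, linear (fun x => mul x y)).
Hypotheses (mulr : forall x, linear (mul x)).

Lemma tmul_linearl v : linear (fun u => tmul mul u v).
Proof. by move=> a u u'; rewrite /tmul tlift_linear. Qed.

Lemma tmulDl u u' v : tmul mul (u + u') v = tmul mul u v + tmul mul u' v.
Proof. by rewrite /tmul linearD. Qed.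

Lemma tmulUl p v :
  tmul mul << p >> v = tmap (mul << p.1 >>) (mul << p.2 >>) v.
Proof. exact: tliftU. Qed.

Lemma tmul_linearr u : linear (tmul mul u).
Proof.
move=> a v v'; move: u; apply: malg_linear_eq => [||p].
- exact: tmul_linearl.
- exact: (linear_combination a (tmul_linearl v) (tmul_linearl v')).
- by rewrite !(tmulUl p); exact: tmap_linear.
Qed.

Lemma tmul_tens x y x' y' :
  tmul mul (tens x y) (tens x' y') = tens (mul x x') (mul y y').
Proof.
move: x; apply: malg_linear_eq => [a u v|a u v|k].
- by rewrite tens_linearl tmul_linearl.
- by rewrite mull tens_linearl.
move: y; apply: malg_linear_eq => [a u v|a u v|l].
- by rewrite tens_linearr tmul_linearl.
- by rewrite mull tens_linearr.
by rewrite tensU tmulUl (tmap_tens _ _ (mulr _) (mulr _)).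
Qed.

End BilinearProduct.

(** By bilinearity it suffices to compare pure tensors of basis vectors, where [f] acts on each
    factor separately. This transports the multiplicativity of the coproduct. *)
Lemma tmap_tmul {K : choiceType} (f : {malg R[K]} -> {malg R[K]})
    (mul mul' : {malg R[K]} -> {malg R[K]} -> {malg R[K]}) u v :
  linear f ->
  (forall y, linear (fun x => mul x y)) -> (forall x, linear (mul x)) ->
  (forall y, linear (fun x => mul' x y)) -> (forall x, linear (mul' x)) ->
  (forall x y, f (mul x y) = mul' (f x) (f y)) ->
  tmap f f (tmul mul u v) = tmul mul' (tmap f f u) (tmap f f v).
Proof.
move=> lf ml mr ml' mr' fM; move: u; apply: malg_linear_eq => [a u w|a u w|p].
- by rewrite tmul_linearl tmap_linear.
- by rewrite tmap_linear tmul_linearl.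
move: v; apply: malg_linear_eq => [a u w|a u w|q].
- by rewrite tmul_linearr tmap_linear.
- by rewrite tmap_linear tmul_linearr.
case: p q => [k l] [k' l']; rewrite -(tensU k l) -(tensU k' l').
(* Chaining with etrans here and below: rewrite would try to unify distinct
   tensors by unfolding them, which does not terminate in practice. *)
transitivity (tmul mul' (tens (f << k >>) (f << l >>))
                        (tens (f << k' >>) (f << l' >>))).
  apply: etrans (congr1 _ (tmul_tens ml mr _ _ _ _)) _.
  apply: etrans (tmap_tens _ _ lf lf) _; rewrite !fM.
  exact: esym (tmul_tens ml' mr' _ _ _ _).
exact: esym (congr2 _ (tmap_tens _ _ lf lf) (tmap_tens _ _ lf lf)).
Qed.

End Tensor.

(** * Uniqueness of the antipode, and transport of Hopf structures along linear bijections *)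

Section HopfTransport.
Set Implicit Arguments.
Unset Strict Implicit.
Context {R : realType} {K : choiceType}.
Local Notation H := {malg R[K]}.

(* S = S * (id * T) = (S * id) * T = T for the convolution product. *)
Lemma antipode_unique (D : hopf_data R K) (S T : H -> H) :
  is_hopf_algebra D -> is_antipode D S -> is_antipode D T -> S =1 T.
Proof.
move=> hD [lS aS] [lT aT].
have lml := hmul_linearl hD; have lmr := hmul_linearr hD.
pose c (y : H) (v : {malg R[(K * K)%type]}) :=
  hmul D (S y) (tlift (fun z w => hmul D z (T w)) v).
pose c' (u : {malg R[(K * K)%type]}) (w : H) :=
  hmul D (tlift (fun y z => hmul D (S y) z) u) (T w).
have cl v : linear (fun y => c y v) by move=> a y z; rewrite /c lS lml.
have cr y : linear (c y) by move=> a u v; rewrite /c tlift_linear lmr.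
have c'l w : linear (fun u => c' u w).
  by move=> a u v; rewrite /c' tlift_linear lml.
have c'r u : linear (c' u) by move=> a y z; rewrite /c' lT lmr.
move=> x.
(* The right counit law writes [S x] as a sum of terms [hcounit D z *: S y], and the right antipode
   identity of [T] expands [hcounit D z *: hunit D]. The formula for [T x] below is the mirror
   image. *)
have -> : S x = tlift c (tmap id (hcomul D) (hcomul D x)).
  rewrite tlift_tmap // -{1}(hcounitr hD x).
  rewrite (linear_tlift _ _ lS); apply: eq_tlift => y z.
  rewrite /c (proj2 (aT _)) (GRing.scalable_linear (lmr _)).
  by rewrite (hmul1r hD) (GRing.scalable_linear lS).
have -> : T x = tlift c' (tmap (hcomul D) id (hcomul D x)).
  rewrite tlift_tmap // -{1}(hcounitl hD x).
  rewrite (linear_tlift _ _ lT); apply: eq_tlift => y z.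
  rewrite /c' (proj1 (aS _)) (GRing.scalable_linear (lml _)).
  by rewrite (hmul1l hD) (GRing.scalable_linear lT).
rewrite -(hcomulA hD); move: (tmap _ _ _); apply: malg_linear_eq => [||p].
- exact: (linear_comp (tlift_linear _) tassoc_linear).
- exact: tlift_linear.
by rewrite [tassoc << _ >>]linextU !tliftU /c /c' !tliftU (hmulA hD).
Qed.

Section Transport.
Variables (D E : hopf_data R K) (f g : H -> H).
Hypotheses (hD : is_hopf_algebra D) (lf : linear f) (lg : linear g).
Hypotheses (fK : cancel f g) (gK : cancel g f).
(** These equations express that [E] is the image of [D] under [f]. As equations on a given [E],
    they apply to a structure that has its own definition, such as the deformed one. *)
Hypothesis mulE : forall x y, hmul E x y = f (hmul D (g x) (g y)).
Hypothesis unitE : hunit E = f (hunit D).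
Hypothesis comulE : forall x, hcomul E x = tmap f f (hcomul D (g x)).
Hypothesis counitE : forall x, hcounit E x = hcounit D (g x).

Let mulf x y : f (hmul D x y) = hmul E (f x) (f y).
Proof. by rewrite mulE !fK. Qed.

Let comulf x : hcomul E (f x) = tmap f f (hcomul D x).
Proof. by rewrite comulE fK. Qed.

Let counitf x : hcounit E (f x) = hcounit D x.
Proof. by rewrite counitE fK. Qed.

Let lmull y : linear (fun x => hmul E x y).
Proof. by move=> a u v; rewrite !mulE lg (hmul_linearl hD) lf. Qed.

Let lmulr x : linear (hmul E x).
Proof. by move=> a u v; rewrite !mulE lg (hmul_linearr hD) lf. Qed.

Let lcomul : linear (hcomul E).
Proof. by move=> a u v; rewrite !comulE lg (hcomul_linear hD) tmap_linear. Qed.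

Let lcounit : linear (hcounit E).
Proof. by move=> a u v; rewrite !counitE lg (hcounit_linear hD). Qed.

Let comulE_A x :
  tassoc (tmap (hcomul E) id (hcomul E x)) = tmap id (hcomul E) (hcomul E x).
Proof.
rewrite comulE; move: (g x) => {}x.
rewrite !tmap_comp //.
(* This pulls all copies of [f] to the outside, so that both sides become the image under
   [tmap f (tmap f f)] of the two sides of coassociativity in [D]. *)
have Ef : hcomul E \o f =1 tmap f f \o hcomul D by move=> y /=; rewrite comulf.
rewrite (eq_tmap (g' := f \o id) Ef) //.
rewrite -(tmap_comp (f := tmap f f)) //; last exact: tmap_linear.
rewrite tassoc_tmap (hcomulA hD) tmap_comp; [|exact: lf|exact: tmap_linear].
by apply: eq_tmap => // y; rewrite /= comulf.
Qed.

(** Both convolution identities for the conjugate are the images under [f] of those for [S] at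
    [g x]. *)
Lemma antipode_transport S : is_antipode D S -> is_antipode E (f \o S \o g).
Proof.
move=> [lS aS]; split; first exact: (linear_comp (linear_comp lf lS) lg).
have lSE := linear_comp (linear_comp lf lS) lg.
move=> x; rewrite comulE counitE unitE; split.
- rewrite tlift_tmap // => [|y a u v]; last by rewrite lSE lmull.
  rewrite -(GRing.scalable_linear lf) -(proj1 (aS _)) (linear_tlift _ _ lf).
  by apply: eq_tlift => y z; rewrite /= fK mulf.
- rewrite tlift_tmap // => [|y a u v]; last by rewrite lSE lmulr.
  rewrite -(GRing.scalable_linear lf) -(proj2 (aS _)) (linear_tlift _ _ lf).
  by apply: eq_tlift => y z; rewrite /= fK mulf.
Qed.

Lemma hopf_transport : is_hopf_algebra E.
Proof.
split=> //.
- by move=> x y z; rewrite !mulE !fK (hmulA hD).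
- by move=> x; rewrite mulE unitE fK (hmul1l hD).
- by move=> x; rewrite mulE unitE fK (hmul1r hD).
(* With [x] written as [f (g x)], each counit law is the image under [f] of the one in [D] at
   [g x]. *)
- move=> x; rewrite -{2}[x]gK comulE tlift_tmap => [|y a u v|y a u v].
  + rewrite -{2}(hcounitl hD (g x)) (linear_tlift _ _ lf).
    apply: eq_tlift => y z.
    by rewrite counitf (GRing.scalable_linear lf).
  + by rewrite lcounit scalerDl scalerA.
  + by rewrite scalerDr !scalerA mulrC.
- move=> x; rewrite -{2}[x]gK comulE tlift_tmap => [|y a u v|y a u v].
  + rewrite -{2}(hcounitr hD (g x)) (linear_tlift _ _ lf).
    apply: eq_tlift => y z.
    by rewrite counitf (GRing.scalable_linear lf).
  + by rewrite scalerDr !scalerA mulrC.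
  + by rewrite lcounit scalerDl scalerA.
- move=> x y; rewrite mulE comulf (hcomulM hD) !comulE.
  exact: (tmap_tmul _ _ lf (hmul_linearl hD) (hmul_linearr hD)).
- by rewrite unitE comulf (hcomul1 hD) tmap_tens.
- by move=> x y; rewrite mulE counitf (hcounitM hD) !counitE.
- by rewrite unitE counitf (hcounit1 hD).
- have [S aS] := hantipode hD.
  by exists (f \o S \o g); exact: antipode_transport.
Qed.

Lemma hopf_isomorphism_transport : is_hopf_isomorphism D E f.
Proof.
have hE := hopf_transport.
split=> //; first by exists g.
move=> S T aS aT x.
(* By uniqueness [T] is the conjugate of [S] by [f], hence intertwined with [S] by [f]. *)
by rewrite -(antipode_unique hE (antipode_transport aS) aT) /= fK.
Qed.

End Transport.
End HopfTransport.

(** * The monoid algebra of multisets as a Hopf algebra *)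

Section MultisetHopf.
Set Implicit Arguments.
Unset Strict Implicit.
Context {R : realType} {I : choiceType}.
Local Notation M := {cmonom I}.
Local Notation H := {malg R[{cmonom I}]}.
Implicit Types (A B C D : M) (x y z : H).

Lemma malgUM A B : << A >> * << B >> = << mmul A B >> :> H.
Proof. by rewrite malgM_def fgmulUU mulr1. Qed.

Lemma malgU1E : << mone >> = 1 :> H.
Proof. exact: mpolyC1E. Qed.

Lemma malg_mulr_linear x : linear (fun y => x * y).
Proof. by move=> a y z; rewrite mulrDr scalerAr. Qed.

Lemma malg_mull_linear y : linear (fun x => x * y).
Proof. by move=> a x z; rewrite mulrDl scalerAl. Qed.

Lemma comul_linear : linear (@comul R I).
Proof. exact: linext_is_linear. Qed.

Lemma counit_linear : linear (@counit R I).
Proof. exact: linext_is_linear. Qed.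

Lemma counitU A : counit << A >> = (A == mone)%:R :> R.
Proof. exact: linextU. Qed.

Lemma cmonom_mulI A : injective (mmul A).
Proof.
move=> B C /eqP/cmP E; apply/eqP/cmP => i.
by have := E i; rewrite !cmM => /addnI.
Qed.

Lemma cmonom_factor A a : A a != 0%N -> A = mmul (ucm a) (divcm A (ucm a)).
Proof.
move=> Aa; apply/eqP/cmP => i; rewrite cmM divcmE cmU.
case: (eqVneq a i) Aa => [<- Aa|_ _]; last by rewrite subn0.
by rewrite subnKC // lt0n.
Qed.

Lemma cmonom_ind (Q : M -> Prop) :
  Q mone -> (forall a A, Q A -> Q (mmul (ucm a) A)) -> forall A, Q A.
Proof.
move=> Q1 QU A; move: {2}(mdeg A) (erefl (mdeg A)) => n.
elim: n A => [|n IH] A An; first by rewrite (mdeg_eq0I An).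
have [A0|[a aA]] := fset_0Vmem (finsupp A).
  by move: An; rewrite mdegE A0 big_seq_fset0.
have EA := cmonom_factor (A := A) (a := a); rewrite cmE_neq0 in EA.
move: An; rewrite (EA aA) mdegM mdegU add1n => -[/IH]; exact: QU.
Qed.

Lemma mbinomU a C : mbinom (mmul (ucm a) C) (ucm a) C = (C a).+1%:R :> R.
Proof.
have nz n : n`!%:R != 0 :> R by rewrite pnatr_eq0 -lt0n fact_gt0.
rewrite /mbinom eqxx (big_fsetD1 a) /=; last first.
  by rewrite -cmE_neq0 cmM cmUU.
rewrite big_seq big1 => [|i]; last first.
  rewrite in_fsetD1 eq_sym => /andP[/negbTE ai _].
  by rewrite cmM cmU ai fact0 add0n mul1r divff.
by rewrite cmM cmUU mulr1 -[1%N`!]/1%N mul1r add1n factS natrM mulfK.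
Qed.

(** When [C] and [D] multiply to [A], both sides are the trinomial coefficient of [mmul (ucm a) A]
    over [ucm a], [C], [D], computed in two orders. Otherwise both vanish. *)
Lemma mbinom_shift a A C D :
  (A a).+1%:R * mbinom A C D =
  (C a).+1%:R * mbinom (mmul (ucm a) A) (mmul (ucm a) C) D :> R.
Proof.
have [<-|ne] := eqVneq (mmul C D) A; last first.
  rewrite /mbinom -monalg.mulmA (inj_eq (@cmonom_mulI _)) (negbTE ne).
  by rewrite !mulr0.
have := mbinom_assoc (R := R) (mmul (ucm a) (mmul C D)) (ucm a) C D.
by rewrite !mbinomU => <-; rewrite mulrC.
Qed.

(** The sum is the coefficient of C (x) D in (a (x) 1) Delta A. At most one split contributes,
    obtained by removing one [a] from [C]; if [C a] is zero there is none. *)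
Lemma sum_mbinom_shift a A C D :
  (A a).+1%:R * \sum_(p \in [set: M * M]%classic) mbinom A p.1 p.2 *:
    (((mmul (ucm a) p.1 == C) && (p.2 == D))%:R : R^o) =
  (C a)%:R * mbinom (mmul (ucm a) A) C D.
Proof.
have [Ca|Ca] := eqVneq (C a) 0%N.
  rewrite Ca mul0r sum_mbinomTE big1 ?mulr0 // => p _.
  case: eqP => [E|_]; last by rewrite scaler0.
  by move: Ca; rewrite -E cmM cmUU.
rewrite {}(cmonom_factor Ca); move: (divcm C (ucm a)) => C'.
rewrite (@sum_mbinom1 _ _ _ _ (C', D)) => [|[B1 B2] /= _ ne]; last first.
  rewrite (inj_eq (@cmonom_mulI _)).
  by move: ne; rewrite -pair_eqE /= => /negbTE ->.
by rewrite !eqxx /= [_ *: _]mulr1 mbinom_shift cmM cmUU add1n.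
Qed.

(* The action of a (x) 1 + 1 (x) a on H (x) H. *)
Definition primitive_mul a : {malg R[(M * M)%type]} -> {malg R[(M * M)%type]} :=
  tlift (fun x y : H => tens (<< ucm a >> * x) y + tens x (<< ucm a >> * y)).

Lemma primitive_mul_linear a : linear (primitive_mul a).
Proof. exact: linext_is_linear. Qed.

Lemma primitive_mul_tens a x y :
  primitive_mul a (tens x y) =
  tens (<< ucm a >> * x) y + tens x (<< ucm a >> * y).
Proof.
apply: tlift_tens => z b u v.
- by rewrite malg_mulr_linear !tens_linearl scalerDr addrACA.
- by rewrite malg_mulr_linear !tens_linearr scalerDr addrACA.
Qed.

(** After scaling by [(A a).+1], the two halves have coefficients [C a] and [D a] times the same
    binomial at (C, D), and [C a + D a] equals [(A a).+1] wherever that binomial is nonzero. *)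
Lemma comul_primitive_mul a A :
  comul << mmul (ucm a) A >> = primitive_mul a (comul << A >>).
Proof.
(* Cocommutativity swaps the factors of the second half, so that its coefficient at (C, D) is that
   of the first half at (D, C). *)
have -> : primitive_mul a (comul << A >>) =
    tlift (fun x y : H => tens (<< ucm a >> * x) y) (comul << A >>) +
    tlift (fun x y : H => tens y (<< ucm a >> * x)) (comul << A >>).
  have S : tlift (fun x y : H => tens y (<< ucm a >> * x)) (comul << A >>) =
      tlift (fun x y : H => tens x (<< ucm a >> * y)) (comul << A >>).
    exact: esym (comul_swap (fun x y : H => tens x (<< ucm a >> * y)) _).
  rewrite [X in _ = _ + X]S; exact: tliftD.
have E C D :
  (tlift (fun x y : H => tens (<< ucm a >> * x) y) (comul << A >>))@_(C, D) =
  \sum_(p \in [set: M * M]%classic) mbinom A p.1 p.2 *: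
    (((mmul (ucm a) p.1 == C) && (p.2 == D))%:R : R^o).
  apply: etrans (congr1 _ (tlift_comulU _ _)) _.
  apply: etrans (mcoeff_sum _ _ _) _; rewrite !sum_mbinomTE.
  apply: eq_bigr => p _.
  by rewrite malgUM mcoeff_tens !mcoeffU1 -natrM mulnb.
have E' C D :
  (tlift (fun x y : H => tens y (<< ucm a >> * x)) (comul << A >>))@_(C, D) =
  (tlift (fun x y : H => tens (<< ucm a >> * x) y) (comul << A >>))@_(D, C).
  apply: etrans (congr1 _ (tlift_comulU _ _)) _.
  apply: etrans (mcoeff_sum _ _ _) _; rewrite E !sum_mbinomTE.
  apply: eq_bigr => p _.
  by rewrite malgUM mcoeff_tens !mcoeffU1 -natrM mulnb andbC.
apply/malgP => -[C D]; rewrite mcoeff_comul mcoeffD.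
rewrite [X in _ = _ + X]E' [X in _ = X + _]E [X in _ = _ + X]E.
have nz : (A a).+1%:R != 0 :> R by rewrite pnatr_eq0.
apply: (mulfI nz); rewrite mulrDr.
rewrite !sum_mbinom_shift (mbinomC _ D C) -mulrDl -natrD.
have [EA|ne] := eqVneq (mmul C D) (mmul (ucm a) A).
  by rewrite -cmM EA cmM cmUU.
by rewrite /mbinom (negbTE ne) !mulr0.
Qed.

(** This is associativity in H (x) H, checked on basis tensors one summand of a (x) 1 + 1 (x) a at a
    time. *)
Lemma primitive_mul_tmul a u v :
  primitive_mul a (tmul *%R u v) = tmul *%R (primitive_mul a u) v.
Proof.
have lp := primitive_mul_linear a.
move: u; apply: malg_linear_eq => [b u w|b u w|[k l]].
- by rewrite tmul_linearl lp.
- by rewrite lp tmul_linearl.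
move: v; apply: malg_linear_eq => [b u w|b u w|[k' l']].
- by rewrite tmul_linearr lp.
- exact: tmul_linearr.
have tM := tmul_tens malg_mull_linear malg_mulr_linear.
rewrite -(tensU k l) -(tensU k' l').
apply: etrans (congr1 _ (tM _ _ _ _)) _.
apply: etrans (primitive_mul_tens _ _ _) _.
apply: esym.
apply: etrans (congr1 (fun w => tmul _ w _) (primitive_mul_tens _ _ _)) _.
apply: etrans (tmulDl _ _ _ _) _.
apply: (congr2 +%R).
- apply: etrans (tM _ _ _ _) _.
  exact: (congr2 tens (esym (mulrA _ _ _)) erefl).
- apply: etrans (tM _ _ _ _) _.
  exact: (congr2 tens erefl (esym (mulrA _ _ _))).
Qed.

Lemma comulU1 : comul << mone >> = << (mone, mone) >> :> {malg R[(M * M)%type]}.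
Proof.
apply/malgP => -[B C]; rewrite mcoeff_comul mcoeffU /=.
rewrite /mbinom cmM_eq1 mdom1 big_seq_fset0 -pair_eqE /= ![mone == _]eq_sym.
by case: andP.
Qed.

Lemma comul1 : comul (1 : H) = tens 1 1.
Proof. by rewrite -malgU1E comulU1 tensU. Qed.

Lemma comulM x y : comul (x * y) = tmul *%R (comul x) (comul y).
Proof.
move: x; apply: malg_linear_eq => [b u w|b u w|A].
- by rewrite malg_mull_linear comul_linear.
- by rewrite comul_linear tmul_linearl.
move: y; apply: malg_linear_eq => [b u w|b u w|B].
- by rewrite malg_mulr_linear comul_linear.
- by rewrite comul_linear tmul_linearr.
(* Adding [a] to [A] applies [primitive_mul a] to both sides: on the right it acts on the left
   factor alone. *)
elim/cmonom_ind: A => [|a A IH]; last first.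
  rewrite malgUM -monalg.mulmA.
  apply: etrans (comul_primitive_mul _ _) _; rewrite -malgUM IH.
  apply: etrans (primitive_mul_tmul _ _ _) _.
  exact: (congr1 (fun u => tmul _ u _) (esym (comul_primitive_mul _ _))).
rewrite [X in comul (X * _)]malgU1E mul1r.
apply: esym; apply: etrans (congr1 (fun u => tmul _ u _) comulU1) _.
apply: etrans (tmulUl _ _ _) _; apply: etrans (tmap_id _).
by apply: eq_tmap => z; rewrite /= malgU1E mul1r.
Qed.

Lemma counitM x y : counit (x * y) = counit x * counit y.
Proof.
move: x; apply: (@malg_linear_eq _ _ R^o (fun x => counit (x * y))).
- by move=> b u w; rewrite malg_mull_linear counit_linear.
- by move=> b u w; rewrite counit_linear mulrDl scalerAl.
move=> A; move: y.
apply: (@malg_linear_eq _ _ R^o (fun y => counit (<< A >> * y))).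
- by move=> b u w; rewrite malg_mulr_linear counit_linear.
- by move=> b u w; rewrite counit_linear mulrDr scalerAr.
move=> B; rewrite malgUM; apply: etrans (counitU _) _.
apply: esym; apply: etrans (congr2 *%R (counitU A) (counitU B)) _.
by rewrite cmM_eq1 -natrM mulnb.
Qed.

Lemma sum_form1 : (linext (fun=> 1) : H -> R^o) 1 = 1.
Proof. by rewrite -malgU1E linextU. Qed.

Definition sum_form : unital_form R I :=
  UnitalForm (linext_is_linear (fun=> 1 : R^o)) sum_form1.

(* In closed form S A = (-1)^|A| A, but only the fact that the coefficients are
   the convolution inverse of the constant 1 matters. *)
Definition antipode : H -> H :=
  linext (fun A => (sum_form^-1)%g << A >> *: << A >>).

(** Every split of [A] multiplies back to [A], so the left identity at [A] is a scalar identity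
    times [<< A >>], namely that the inverse of [sum_form] convolved with [sum_form] is the counit.
    Commutativity and cocommutativity give the right one. *)
Lemma antipodeP : is_antipode (@multiset_hopf R I) antipode.
Proof.
have E x : tlift (fun y z => antipode y * z) (comul x) = counit x *: 1.
  move: x; apply: malg_linear_eq => [||A].
  - by move=> b u w; rewrite comul_linear tlift_linear.
  - by move=> b u w; rewrite counit_linear scalerDl scalerA.
  (* The counit vanishes unless [A] is [mone], where [<< A >>] is the unit; both sides are now
     multiples of [<< A >>]. *)
  have E1 : counit << A >> *: 1 = counit << A >> *: << A >> :> H.
    have [->|ne] := eqVneq A mone; first by rewrite malgU1E.
    have -> : counit << A >> = 0 :> R.
      by apply: etrans (counitU _) _; rewrite (negbTE ne).
    exact: etrans (scale0r _) (esym (scale0r _)).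
  have ES : counit << A >> = star (sum_form^-1)%g sum_form << A >>.
    pose ev (l : unital_form R I) := l << A >>.
    exact: esym (congr1 ev (mulVg sum_form)).
  rewrite E1 ES /star 2!tlift_comulU !sum_mbinomTE scaler_suml.
  apply: eq_big_seq => p; rewrite in_splits => /eqP Ep.
  rewrite /antipode linextU /= [linext _ << p.2 >>]linextU mulr1.
  rewrite -scalerAl malgUM Ep; exact: scalerA.
split; first exact: linext_is_linear.
move=> x; split=> /=; first exact: E.
by rewrite comul_swap -E; apply: eq_tlift => A B; exact: mulrC.
Qed.

Lemma multiset_hopf_algebra : is_hopf_algebra (@multiset_hopf R I).
Proof.
split=> /=.
- exact: malg_mull_linear.
- exact: malg_mulr_linear.
- exact: mulrA.
- exact: mul1r.
- exact: mulr1.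
- exact: comul_linear.
- exact: counit_linear.
- exact: comulA.
- by move=> x; exact: (counit_comul (f := id)).
- by move=> x; rewrite comul_swap; exact: (counit_comul (f := id)).
- exact: comulM.
- exact: comul1.
- exact: counitM.
- exact: counit1.
- by exists antipode; exact: antipodeP.
Qed.

(** This rests on the normalisation [uform1], and explains why the deformed structure keeps the
    unit. *)
Lemma phi1 (l : unital_form R I) : phi l 1 = 1.
Proof.
by rewrite /phi -malgU1E comulU1 tliftU /= malgU1E uform1 scale1r.
Qed.

End MultisetHopf.

(** * The Wick map as a deformation map *)

Lemma wickE (R : realType) (d : measure_display) (T : measurableType d)
    (P : probability T R) (I : choiceType) (X : I -> {RV P >-> R}) :
  wick X =1 phi (moment_form X)^-1%g.
Proof.
have lW : linear (wick X) by exact: linext_is_linear.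
have W x : wick X (phi (moment_form X) x) = x.
  move: x; apply: malg_linear_eq => [|//|A].
    exact: (linear_comp lW (phi_linear _)).
  rewrite [RHS](wick_rec X A) /phi (linear_tlift _ _ lW) tlift_comulU.
  apply: eq_fsbigr => p _; rewrite (GRing.scalable_linear lW).
  by rewrite [moment_form X _]linextU.
(* A left inverse of a bijection is its inverse: [W] is evaluated at the preimage of [x]. *)
by move=> x; rewrite -{1}[x](phiVK (moment_form X)) W.
Qed.

Theorem theorem5p3 (R : realType) (d : measure_display) (T : measurableType d)
    (P : probability T R) (I : choiceType) (X : I -> {RV P >-> R})
    (finite_moments : forall (a : I) (n : nat),
      ('E_P[(fun w => `|X a w| ^+ n)%R] < +oo)%E) :
  wick X =1 phi (moment_form X)^-1%g /\
  is_hopf_isomorphism (multiset_hopf : hopf_data R {cmonom I})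
    (deformed_hopf (moment_form X)) (wick X) /\
  (forall A1 A2 : {malg R[{cmonom I}]},
    wick X (A1 * A2) =
    deformed_mul (moment_form X) (wick X A1) (wick X A2)).
Proof.
have isoW : is_hopf_isomorphism (multiset_hopf : hopf_data R {cmonom I})
    (deformed_hopf (moment_form X)) (wick X).
  have -> : wick X = phi (moment_form X)^-1%g by apply/funext; exact: wickE.
  (* With this [g], the transport equations for product, coproduct and counit are the definitions of
     the deformed operations; only the unit calls for [phi1]. *)
  apply: (hopf_isomorphism_transport (g := phi (moment_form X))).
  - exact: multiset_hopf_algebra.
  - exact: phi_linear.
  - exact: phi_linear.
  - exact: phiVK.
  - exact: phiK.
  - by [].
  - exact: esym (phi1 _).
  - by [].
  - by [].
split; first exact: wickE.
by split=> //; exact: hiso_mul isoW.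
Qed.
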